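(* Let $n\geq 1$ and let $K\neq\Delta_{[n+1]}$ be a simplicial complex on $[n+1]$. Then the Dehn-Sommerville equations $h_i(\mathrm{Bier}(K))=h_{n-i}(\mathrm{Bier}(K))$ hold for all $0\leq i\leq n$, where $\dim\mathrm{Bier}(K)=n-1$.
   Context: $[m]=\{1,\dots,m\}$. A simplicial complex on a finite set $S$ is a non-empty family $K\subseteq 2^{S}$ closed under taking subsets (elements of $S$ need not be vertices); $\Delta_{[m]}=2^{[m]}$. The dimension of a face is its cardinality minus one, and the dimension of a complex is the maximal dimension of its faces. Let $[m']=\{1',\dots,m'\}$ be a disjoint copy of $[m]$; for $J\subseteq[m]$ let $J'=\{j'\mid j\in J\}$. For a simplicial complex $K\neq\Delta_{[m]}$ on $[m]$, $m\ge 2$, the Alexander dual $K^\vee$ is the simplicial complex on $[m']$ whose inclusion-maximal faces are exactly the sets $[m']\setminus I'$ with $I$ a minimal (by inclusion) non-face of $K$. The Bier sphere is $\mathrm{Bier}(K)=\{I\sqcup J'\mid I\in K,\ J'\in K^\vee,\ I\cap J=\varnothing\}$, a simplicial complex on $[m]\sqcup[m']$. For an $(n-1)$-dimensional simplicial complex $L$ let $f_j$ be the number of $j$-dimensional faces, $-1\le j\le n-1$ (so $f_{-1}=1$). Its $h$-vector $(h_0,\dots,h_n)$ is defined by $\sum_{i=0}^n h_i t^{n-i}=\sum_{j=-1}^{n-1} f_j (t-1)^{n-j-1}$, and $h_i(L)=h_i$. *)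

(* Defs.v *)
From mathcomp Require Import all_boot all_order all_algebra.

Set Implicit Arguments.
Unset Strict Implicit.
Unset Printing Implicit Defensive.

Import GRing.Theory.
Local Open Scope ring_scope.

(* A complex on T may have ghost vertices: [set x] \in K is not required. *)
Definition simplicial_complex (T : finType) (K : {set {set T}}) : Prop :=
  K != set0 /\ (forall F G : {set T}, G \in K -> F \subset G -> F \in K).

Definition full_simplex (T : finType) : {set {set T}} := powerset [set: T].

Definition face_dim (T : finType) (F : {set T}) : int := #|F|%:Z - 1.

(* One more than the dimension; a natural number even for the complex
   [set set0], whose dimension is -1. *)
Definition cpx_rank (T : finType) (L : {set {set T}}) : nat :=
  (\max_(F in L) #|F|)%N.

Definition cpx_dim (T : finType) (L : {set {set T}}) : int :=
  (cpx_rank L)%:Z - 1.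

Definition fvec (T : finType) (L : {set {set T}}) (j : int) : nat :=
  #|[set F in L | face_dim F == j]|.

(* With d = dim L + 1 and j = k - 1, this is
   \sum_(-1 <= j <= d - 1) f_j (t - 1)^(d - j - 1). *)
Definition hpoly (T : finType) (L : {set {set T}}) : {poly int} :=
  \sum_(k < (cpx_rank L).+1)
    (fvec L (k%:Z - 1))%:R *: ('X - 1) ^+ (cpx_rank L - k).

(* Meaningful for i <= dim L + 1 only, because of the truncated subtraction;
   see hvecE. *)
Definition hvec (T : finType) (L : {set {set T}}) (i : nat) : int :=
  (hpoly L)`_(cpx_rank L - i).

Lemma hvecE (T : finType) (L : {set {set T}}) :
  \sum_(i < (cpx_rank L).+1) hvec L i *: 'X^(cpx_rank L - i) = hpoly L.
Proof.
have sz : (size (hpoly L) <= (cpx_rank L).+1)%N.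
  apply: (leq_trans (size_sum _ _ _)); apply/bigmax_leqP => k _.
  apply: (leq_trans (size_scale_leq _ _)).
  by rewrite -polyC1 size_exp_XsubC ltnS leq_subr.
rewrite (reindex_inj rev_ord_inj) /=; apply/polyP => c.
under eq_bigr => i _ do rewrite /hvec subSS subKn ?leq_ord //.
rewrite -(poly_def _ (fun i => (hpoly L)`_i)) coef_poly.
by case: ltnP => // rc; rewrite nth_default // (leq_trans sz).
Qed.

Definition min_nonface (T : finType) (K : {set {set T}}) (I : {set T}) : bool :=
  minset (fun A : {set T} => A \notin K) I.

(* The dual lives on a copy of T, here identified with T; the two copies are
   made disjoint in bier.  Its facets are given by alexander_dual_facets. *)
Definition alexander_dual (T : finType) (K : {set {set T}}) : {set {set T}} :=
  [set J : {set T} | [exists I : {set T}, min_nonface K I && (J \subset ~: I)]].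

Lemma alexander_dual_complex (T : finType) (K : {set {set T}}) :
  simplicial_complex K -> K <> full_simplex T ->
  simplicial_complex (alexander_dual K).
Proof.
move=> [K0 cK] neK; split=> [|F G].
  have [A AK] : exists A, A \notin K.
    apply/existsP; rewrite -negb_forall; apply/negP => /forallP H.
    by apply: neK; apply/setP => A; rewrite H powersetE subsetT.
  have [I mI _] := @minset_exists _ (fun A : {set T} => A \notin K) _ AK.
  apply/set0Pn; exists set0; rewrite inE; apply/existsP; exists I.
  by rewrite /min_nonface mI sub0set.
rewrite !inE => /existsP[I /andP[mI GI]] FG; apply/existsP; exists I.
by rewrite mI (subset_trans FG).
Qed.

Lemma alexander_dual_facets (T : finType) (K : {set {set T}}) (F : {set T}) :
  maxset (fun J => J \in alexander_dual K) F <->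
  exists2 I : {set T}, min_nonface K I & F = ~: I.
Proof.
split=> [/maxsetP[]|[I mI ->]].
  rewrite inE => /existsP[I /andP[mI FI]] mx; exists I => //.
  apply/esym/mx => //; rewrite inE; apply/existsP; exists I.
  by rewrite mI subxx.
apply/maxsetP; split=> [|B].
  by rewrite inE; apply/existsP; exists I; rewrite mI subxx.
rewrite inE => /existsP[I1 /andP[mI1 BI1]] IB.
have s11 : I1 \subset I by rewrite -setCS (subset_trans IB).
have eI : I1 = I.
  move/minsetP: mI => [_]; apply=> //.
  by case/minsetP: mI1.
by apply/eqP; rewrite eqEsubset IB andbT -eI.
Qed.

Definition djoin (T : finType) (I J : {set T}) : {set T + T} :=
  [set inl i | i in I] :|: [set inr j | j in J].

Lemma in_djoin (T : finType) (I J : {set T}) (v : T + T) :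
  (v \in djoin I J) = match v with inl x => x \in I | inr x => x \in J end.
Proof.
rewrite inE; case: v => x.
  rewrite mem_imset; last by move=> ? ? [].
  by apply/orb_idr => /imsetP[].
rewrite [X in _ || X]mem_imset; last by move=> ? ? [].
by apply/orb_idl => /imsetP[].
Qed.

Definition bier (T : finType) (K : {set {set T}}) : {set {set T + T}} :=
  [set djoin I J | I in K, J in alexander_dual K & [disjoint I & J]].

Lemma bier_complex (T : finType) (K : {set {set T}}) :
  simplicial_complex K -> K <> full_simplex T -> simplicial_complex (bier K).
Proof.
move=> cpxK neK; have [] := alexander_dual_complex cpxK neK.
case: cpxK => /set0Pn[A AK] cK /set0Pn[B BD] cD; split=> [|G F].
  apply/set0Pn; exists (djoin set0 set0); apply/imset2P.
  exists set0 set0 => //; first exact: cK AK (sub0set A).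
  by rewrite inE (cD _ _ BD (sub0set B)) -setI_eq0 set0I eqxx.
move=> /imset2P[I J IK]; rewrite inE => /andP[JD dIJ] -> GF; apply/imset2P.
have sI : inl @^-1: G \subset I.
  by apply/subsetP => x; rewrite inE => xG; have := subsetP GF _ xG; rewrite in_djoin.
have sJ : inr @^-1: G \subset J.
  by apply/subsetP => x; rewrite inE => xG; have := subsetP GF _ xG; rewrite in_djoin.
exists (inl @^-1: G) (inr @^-1: G); first exact: cK IK sI.
  by rewrite inE (cD _ _ JD sJ) (disjointWl sI) // (disjointWr sJ).
by apply/setP => -[] x; rewrite in_djoin inE.
Qed.

(* Main.v *)
Require Import Defs.
From mathcomp Require Import all_boot all_order all_algebra.
From mathcomp Require Import zify.
Import GRing.Theory.
Local Open Scope ring_scope.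

(* The faces of Bier(K) correspond to the pairs I \subset B with I in K and
   B := ~: J not in K, and then |I| + |J| = n + 1 - |B \ I|.  So the h-polynomial
   is h = \sum_(I \subset B) (t - 1)^(|B \ I| - 1).  In (t - 1) h the sum over
   all B containing I is t^(n + 1 - |I|), while that over the B in K, exchanged
   with the sum over I (every subset of B is in K), is \sum_(B in K) t^|B|.
   Hence (t - 1) h = \sum_(I in K) (t^(n + 1 - |I|) - t^|I|) is antisymmetric
   in degree n + 1, and h is symmetric in degree n. *)

(** The binomial theorem, obtained by expanding a product of two-term sums over all of [T]: the term
    for [A] picks the indicator of [S] on [A], so it vanishes unless [A \subset S], and otherwise
    leaves one [x] for each point of [S :\: A]. *)
Lemma sum_subset_expr (R : comPzRingType) (T : finType) (S : {set T}) (x : R) :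
  \sum_(A : {set T} | A \subset S) x ^+ (#|S| - #|A|) = (x + 1) ^+ #|S|.
Proof.
transitivity (\prod_(i : T) ((i \in S)%:R + (if i \in S then x else 1))).
  rewrite bigA_distr big_mkcond /=; apply: eq_bigr => A _.
  case: (boolP (A \subset S)) => [AS|/subsetPn[i iA iS]]; last first.
    by rewrite (bigD1 i) //= iA (negPf iS) mul0r.
  rewrite -cardsDS // -prodr_const [RHS]big_mkcond /=; rewrite [LHS]big_mkcond /=.
  apply: eq_bigr => i _; rewrite inE; case: (boolP (i \in A)) => //= iA.
  by rewrite (subsetP AS _ iA).
rewrite -prodr_const [RHS]big_mkcond /=; apply: eq_bigr => i _.
by case: (i \in S); rewrite ?add0r // addrC.
Qed.

Lemma sum_superset_expr (R : comPzRingType) (T : finType) (S : {set T}) (x : R) :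
  \sum_(B : {set T} | S \subset B) x ^+ (#|B| - #|S|) = (x + 1) ^+ (#|T| - #|S|).
Proof.
have eC (A : {set T}) : (#|T| - #|A|)%N = #|~: A| by rewrite -(cardsC A) addKn.
rewrite (reindex_inj (@setC_inj T)) eC -sum_subset_expr; apply: eq_big => A.
  by rewrite -setCS setCK.
move=> _; congr (_ ^+ _).
by have := cardsC A; have := cardsC S; lia.
Qed.

(** As [K] is closed under subsets, a set is a non-face exactly when it contains a minimal one. *)
Lemma alexander_dualE (T : finType) (K : {set {set T}}) (J : {set T}) :
  simplicial_complex K -> (J \in alexander_dual K) = (~: J \notin K).
Proof.
move=> [_ cK]; rewrite inE; apply/existsP/idP => [[I /andP[/minsetP[IK _] JI]]|JK].
  by apply: contra IK => JK; apply: cK JK _; rewrite -setCS setCK.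
have [I mI IJ] := @minset_exists _ (fun A : {set T} => A \notin K) _ JK.
by exists I; rewrite /min_nonface mI -setCS setCK.
Qed.

Lemma djoinK (T : finType) (I J : {set T}) :
  inl @^-1: djoin I J = I /\ inr @^-1: djoin I J = J.
Proof. by split; apply/setP => x; rewrite inE in_djoin. Qed.

Lemma djoin_preim (T : finType) (G : {set T + T}) :
  djoin (inl @^-1: G) (inr @^-1: G) = G.
Proof. by apply/setP => -[] x; rewrite in_djoin inE. Qed.

Lemma card_djoin (T : finType) (I J : {set T}) :
  #|djoin I J| = (#|I| + #|J|)%N.
Proof.
rewrite cardsU !card_imset; try by move=> ? ? [].
rewrite -[RHS]subn0; congr (_ - _)%N; apply/eqP; rewrite cards_eq0 -subset0.
apply/subsetP => v; rewrite !inE => /andP[/imsetP[i _ ->]].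
by case/imsetP.
Qed.

Lemma djoin_bier (T : finType) (K : {set {set T}}) (I B : {set T}) :
  simplicial_complex K ->
  (djoin I (~: B) \in bier K) = [&& I \in K, B \notin K & I \subset B].
Proof.
move=> cK; apply/imset2P/and3P => [[I' J' I'K]|[IK BK IB]].
  rewrite inE alexander_dualE // => /andP[J'K dIJ] e.
  have [eI eJ] := djoinK _ I (~: B); move: eI eJ.
  rewrite e !(djoinK _ _ _).1 !(djoinK _ _ _).2 => <- eJ.
  rewrite -(setCK B) -eJ; split=> //; by rewrite -disjoints_subset.
exists I (~: B) => //.
by rewrite inE alexander_dualE // setCK BK disjoints_subset setCK.
Qed.

Lemma big_bier (T : finType) (K : {set {set T}}) (R : nmodType)
    (F : {set T + T} -> R) :
  simplicial_complex K ->
  \sum_(G in bier K) F G =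
  \sum_(I in K) \sum_(B : {set T} | (B \notin K) && (I \subset B))
    F (djoin I (~: B)).
Proof.
move=> cK; rewrite pair_big_dep /=.
rewrite (reindex (fun p : {set T} * {set T} => djoin p.1 (~: p.2))) /=.
  by apply: eq_bigl => p; rewrite djoin_bier.
apply: onW_bij.
exists (fun G : {set T + T} => (inl @^-1: G, ~: inr @^-1: G)) => [[I B]|G] /=.
  by rewrite (djoinK _ _ _).1 (djoinK _ _ _).2 setCK.
by rewrite setCK djoin_preim.
Qed.

Lemma hpolyE (T : finType) (L : {set {set T}}) :
  hpoly L = \sum_(F in L) ('X - 1) ^+ (cpx_rank L - #|F|).
Proof.
have le F : F \in L -> (#|F| < (cpx_rank L).+1)%N.
  by move=> FL; rewrite ltnS; apply: (leq_bigmax_cond _ FL).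
rewrite (partition_big (fun F : {set T} => inord #|F| : 'I_(cpx_rank L).+1) xpredT) //=.
apply: eq_bigr => k _.
rewrite (eq_bigr (fun=> ('X - 1) ^+ (cpx_rank L - k))); last first.
  by move=> F /andP[FL /eqP <-]; rewrite inordK ?le.
rewrite sumr_const scaler_nat /fvec; congr (_ *+ _).
apply: eq_card => F; rewrite inE [RHS]unfold_in.
case: (boolP (F \in L)) => //= FL.
by rewrite /face_dim -val_eqE /= inordK ?le //; lia.
Qed.

Lemma cpx_rank_bier (T : finType) (K : {set {set T}}) :
  simplicial_complex K -> K <> full_simplex T -> cpx_rank (bier K) = #|T|.-1.
Proof.
move=> cK neK; have [K0 subK] := cK; apply/eqP; rewrite eqn_leq; apply/andP; split.
  apply/bigmax_leqP => G; rewrite -(djoin_preim _ G) -(setCK (inr @^-1: G)).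
  move: (inl @^-1: G) (~: inr @^-1: G) => I B; rewrite djoin_bier //.
  case/and3P=> IK BK IB; rewrite card_djoin.
  have /proper_card : I \proper B.
    by rewrite properEneq IB andbT; apply: contraNneq BK => <-.
  by have := cardsC B; lia.
have [A AK] : exists A, A \notin K.
  apply/existsP; rewrite -negb_forall; apply/negP => /forallP H.
  by apply: neK; apply/setP => A; rewrite H powersetE subsetT.
(* The bound is attained by a minimal non-face [B] and [I = B :\ x], so that [B] has just one point
   more than [I]. *)
have [B /minsetP[BK minB] _] := @minset_exists _ (fun A : {set T} => A \notin K) _ AK.
have [x xB] : exists x, x \in B.
  apply/set0Pn; apply: contraNneq BK => ->.
  by case/set0Pn: K0 => C CK; apply: subK CK (sub0set C).
have BxB : B :\ x \subset B by apply: subD1set.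
have BxK : B :\ x \in K.
  apply/negPn/negP => /minB /(_ BxB) e.
  by move: xB; rewrite -e !inE eqxx.
have fB : djoin (B :\ x) (~: B) \in bier K by rewrite djoin_bier // BxK BK.
apply: leq_trans (leq_bigmax_cond _ fB); rewrite card_djoin.
by have := cardsC B; have := cardsD1 x B; rewrite xB; lia.
Qed.

Lemma hpoly_bier_mul (T : finType) (K : {set {set T}}) :
  simplicial_complex K -> K <> full_simplex T ->
  ('X - 1) * hpoly (bier K) = \sum_(I in K) ('X^(#|T| - #|I|) - 'X^#|I|).
Proof.
move=> cK neK; rewrite hpolyE cpx_rank_bier // big_bier // mulr_sumr.
pose q (I B : {set T}) : {poly int} := ('X - 1) ^+ (#|B| - #|I|).
transitivity (\sum_(I in K) (\sum_(B : {set T} | I \subset B) q I B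
                - \sum_(B in K | I \subset B) q I B)).
  apply: eq_bigr => I IK; rewrite mulr_sumr [in RHS](bigID (mem K)) /=.
  rewrite [X in _ = X + _ - _](eq_bigl (fun B => (B \in K) && (I \subset B))); last first.
    by move=> B; rewrite andbC.
  rewrite [RHS]addrC addKr; apply: eq_big => [B|B /andP[BK IB]]; first by rewrite andbC.
  (* Strictness gives [#|B| - #|I| >= 1], so the exponent in the h-polynomial is not truncated and
     the factor ['X - 1] raises it to [#|B| - #|I|]. *)
  have /proper_card : I \proper B.
    by rewrite properEneq IB andbT; apply: contraNneq BK => <-.
  rewrite -exprS card_djoin => lt; congr (_ ^+ _).
  by rewrite -(cardsC B); move: lt; lia.
rewrite !sumrB; congr (_ - _).
  by apply: eq_bigr => I _; rewrite sum_superset_expr subrK.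
rewrite (exchange_big_dep (mem K)) /=; last by move=> I B _ /andP[].
(* Writing ['X] as [('X - 1) + 1] turns ['X^#|B|] into a sum over all subsets of [B], each of which
   lies in [K]. *)
apply: eq_bigr => B BK; rewrite -[in RHS](subrK 1 'X) -sum_subset_expr.
apply: eq_bigl => I; rewrite BK /=; case: (boolP (I \subset B)) => IB; rewrite ?andbF //.
by rewrite (cK.2 _ _ BK IB).
Qed.

Lemma coef_palindrome (R : nzRingType) (p : {poly R}) (n : nat) :
  (size p <= n.+1)%N ->
  (forall k, (k <= n.+1)%N ->
     (('X - 1) * p)`_k = - (('X - 1) * p)`_(n.+1 - k)) ->
  forall i, (i <= n)%N -> p`_i = p`_(n - i).
Proof.
move=> sz anti; elim=> [|i IH] lin.
  have := anti 0%N isT; rewrite !mulrBl !mul1r !coefB !coefXM subn0 /=.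
  by rewrite (nth_default _ sz) sub0r subr0 => /oppr_inj ->; rewrite subn0.
have := anti i.+1 (leqW lin); rewrite !mulrBl !mul1r !coefB !coefXM /=.
rewrite subSS subn_eq0 leqNgt lin /= (IH (ltnW lin)) -subnS opprB.
by move/addrI/oppr_inj.
Qed.

Theorem proposition4p3 (n : nat) (hn : (1 <= n)%N)
    (K : {set {set 'I_n.+1}}) (hK : simplicial_complex K)
    (hK1 : K <> full_simplex 'I_n.+1) :
  cpx_dim (bier K) = n%:Z - 1 /\
  (forall i : nat, (i <= n)%N -> hvec (bier K) i = hvec (bier K) (n - i)%N).
Proof.
have rk : cpx_rank (bier K) = n by rewrite cpx_rank_bier // card_ord.
split=> [|i lin]; first by rewrite /cpx_dim rk.
rewrite /hvec rk; apply: coef_palindrome; last by apply: leq_subr.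
  rewrite hpolyE rk; apply: (leq_trans (size_sum _ _ _)); apply/bigmax_leqP => F _.
  by rewrite -polyC1 size_exp_XsubC ltnS leq_subr.
move=> k lk; rewrite hpoly_bier_mul // card_ord !coef_sum -sumrN.
apply: eq_bigr => I _; rewrite !coefB !coefXn opprB.
have lI : (#|I| <= n.+1)%N by have := max_card I; rewrite card_ord.
(* Since [k] and [#|I|] are at most [n + 1], [k = n + 1 - #|I|] holds iff [n + 1 - k = #|I|]. *)
by congr ((nat_of_bool _)%:R - (nat_of_bool _)%:R); lia.
Qed.
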